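(* Let $(X,\mathcal{R}_\mu,\mu)$ be a probability space (with values in a complete non-Archimedean valued field $K$) which is compact in the $\mathcal{R}_\mu$-topology and satisfies $\|X\|_\mu=1$, and let $T:X\to X$ be a measure preserving transformation. Then $$h_\mu(T)\le h_{top}(T),$$ and equality holds if $X_0(\mu)=\emptyset$ and $\|A\|_\mu=1$ for every nonempty set $A\in\mathcal{R}_\mu$.
   Context: Let $K$ be a complete non-Archimedean valued field with absolute value $|\cdot|$. For a set $X$, a covering ring is a collection $\mathcal{R}\subseteq\mathcal{P}(X)$ that covers $X$ and is closed under $A\cap B$, $A\cup B$, $A\setminus B$. It is separating if for all distinct $x,y\in X$ there is $A\in\mathcal{R}$ with $x\in A$, $y\notin A$; it is an algebra if $X\in\mathcal{R}$. All covering rings are assumed separating. The $\mathcal{R}$-topology is the topology on $X$ with basis $\mathcal{R}$. A subcollection $\mathcal{A}\subset\mathcal{R}$ is shrinking if the intersection of any two elements of $\mathcal{A}$ contains an element of $\mathcal{A}$. A measure is a map $\mu:\mathcal{R}\to K$ that is additive on disjoint sets, bounded (for every $A\in\mathcal{R}$ the set $\{\mu(B):B\in\mathcal{R},B\subset A\}$ is bounded), and continuous (if $\mathcal{A}\subset\mathcal{R}$ is shrinking with $\bigcap_{A\in\mathcal{A}}A=\emptyset$, then for every $\epsilon>0$ there is $A_0\in\mathcal{A}$ with $|\mu(A)|<\epsilon$ for every $A\in\mathcal{A}$ contained in $A_0$). Put $N_\mu(x)=\inf\{\sup\{|\mu(B)|:B\in\mathcal{R},B\subset U\}:U\in\mathcal{R},x\in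 U\}$ and $X_0(\mu)=\{x\in X:N_\mu(x)=0\}$. For $f:X\to K$ put $\|f\|_\mu=\sup_{x\in X}|f(x)|N_\mu(x)$. Step functions are finite $K$-linear combinations of indicator functions $\chi_A$, $A\in\mathcal{R}$; the integral is the linear functional on step functions with $\int\chi_A\,d\mu=\mu(A)$; $f$ is integrable if there are step functions $f_n$ with $\|f_n-f\|_\mu\to0$, and the integral extends by continuity. $\mathcal{R}_\mu$ is the collection of sets $A\subset X$ with $\chi_A$ integrable; it is a covering ring containing $\mathcal{R}$ and $\mu$ extends to it by $\mu(A)=\int\chi_A\,d\mu$. For $A\in\mathcal{R}_\mu$, $\|A\|_\mu=\sup\{|\mu(B)|:B\in\mathcal{R}_\mu,B\subset A\}$. The triple $(X,\mathcal{R}_\mu,\mu)$ is a probability space if $\mathcal{R}$ is an algebra and $\mu(X)=1$. A measure preserving transformation is a map $T:X\to X$ that is continuous for the $\mathcal{R}_\mu$-topology and satisfies $\mu(T^{-1}B)=\mu(B)$ for all $B\in\mathcal{R}_\mu$. Measure entropy (logarithms in base 2). A partition is a collection of disjoint elements of $\mathcal{R}_\mu$ covering $X$. Finite subalgebras $\mathcal{A}$ of $\mathcal{R}_\mu$ correspond to finite partitions: if $\mathcal{A}=\{C_1,\dots,C_k\}$, then $\alpha(\mathcal{A})$ is the partition into the nonempty sets $B_1\cap\dots\cap B_k$ with each $B_i\in\{C_i,X\setminus C_i\}$. For partitions, $\alpha\vee\beta=\{A\cap B:A\in\alpha,B\in\beta\}$, and $\mathcal{A}\vee\mathcal{B}$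 is the finite subalgebra with $\alpha(\mathcal{A}\vee\mathcal{B})=\alpha(\mathcal{A})\vee\alpha(\mathcal{B})$. For a finite partition $\alpha$, $\mathcal{M}(\alpha)=\{A\in\alpha:\|A\|_\mu>0\}$ and $M(\alpha)=\#\mathcal{M}(\alpha)$. Put $H_\mu(\mathcal{A})=\min_{A\in\mathcal{M}(\alpha(\mathcal{A}))}\|A\|_\mu\cdot\log M(\alpha(\mathcal{A}))$, $h_\mu(T,\mathcal{A})=\lim_{n\to\infty}\frac1n H_\mu(\mathcal{A}\vee T^{-1}\mathcal{A}\vee\dots\vee T^{-(n-1)}\mathcal{A})$, and $h_\mu(T)=\sup_{\mathcal{A}}h_\mu(T,\mathcal{A})$ over all finite subalgebras $\mathcal{A}$ of $\mathcal{R}_\mu$. Topological entropy (with respect to the $\mathcal{R}_\mu$-topology on compact $X$). For an open cover $\mathcal{U}$, $N(\mathcal{U})$ is the least cardinality of a subcover and $H_{top}(\mathcal{U})=\log N(\mathcal{U})$; $\mathcal{U}\vee\mathcal{W}=\{U\cap W:U\in\mathcal{U},W\in\mathcal{W}\}$; $h_{top}(T,\mathcal{U})=\lim_{n\to\infty}\frac1n H_{top}(\mathcal{U}\vee T^{-1}\mathcal{U}\vee\dots\vee T^{-(n-1)}\mathcal{U})$; $h_{top}(T)=\sup_{\mathcal{U}}h_{top}(T,\mathcal{U})$ over all open covers of $X$. *)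

(* Defs.v *)
From HB Require Import structures.
From mathcomp Require Import all_boot all_order all_algebra.
From mathcomp Require Import finmap.
From mathcomp Require Import all_classical all_reals all_analysis.

Set Implicit Arguments.
Unset Strict Implicit.
Unset Printing Implicit Defensive.

Import Order.TTheory GRing.Theory Num.Theory.
Import numFieldNormedType.Exports.

Local Open Scope classical_set_scope.
Local Open Scope ring_scope.

(* The absolute value takes its values in an arbitrary copy R of the reals;
   the trivial absolute value is allowed. *)
Record nonarchimedean_abs (R : realType) (K : fieldType) (v : K -> R) : Prop := {
  nabs_ge0 : forall x, 0 <= v x;
  nabs_eq0 : forall x, v x = 0 <-> x = 0;
  nabsM : forall x y, v (x * y) = v x * v y;
  nabsD : forall x y, v (x + y) <= Num.max (v x) (v y)
}.

Definition abs_complete (R : realType) (K : fieldType) (v : K -> R) : Prop :=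
  forall u : nat -> K,
    (forall e : R, 0 < e ->
      exists N, forall m n, (N <= m)%N -> (N <= n)%N -> v (u m - u n) < e) ->
    exists l : K, (fun n => v (u n - l)) @ \oo --> (0 : R).

Record covering_ring (X : Type) (G : set (set X)) : Prop := {
  cring_cover : \bigcup_(A in G) A = setT;
  cring_setI : setI_closed G;
  cring_setU : setU_closed G;
  cring_setD : setD_closed G;
  cring_separating : forall x y : X, x <> y -> exists A, [/\ G A, A x & ~ A y]
}.

(* The family G is declared as a subbase, which needs no side condition; when
   G covers X and is stable under intersection it is a base, see
   [open_ring_topologyP]. *)
Definition ring_topology (X : choiceType) (G : set (set X)) : Type := X.

HB.instance Definition _ (X : choiceType) (G : set (set X)) :=
  Choice.on (ring_topology G).
HB.instance Definition _ (X : choiceType) (G : set (set X)) :=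
  isSubBaseTopological.Build (ring_topology G) G id.

Lemma open_ring_topologyP (X : choiceType) (G : set (set X))
    (U : set (ring_topology G)) : covering_ring G ->
  open U <-> forall x, U x -> exists A : set X, [/\ G A, A x & A `<=` U].
Proof.
move=> GP; split=> [Uop x Ux|GU].
  have [D' sD' UE] : [set \bigcup_(i in D') i |
    D' in subset^~ (finI_from G id)] U by [].
  move: Ux; rewrite -UE => -[B0 D'B Bx].
  have [D DG DE] := sD' _ D'B; rewrite -DE /= in D'B Bx => {DE}.
  suff [A [GA Ax AD]] : exists A : set X,
      [/\ G A, A x & A `<=` \bigcap_(i in [set` D]) i].
    by exists A; split => // y /AD Dy; exists (\bigcap_(i in [set` D]) i).
  suff H (s : seq (set X)) : (forall C, C \in s -> G C) ->
      (forall C, C \in s -> C x) ->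
      exists A : set X, [/\ G A, A x & forall C, C \in s -> A `<=` C].
    have [||A [GA Ax AD]] := H (D : seq _).
    - by move=> C CD; have := DG C CD; rewrite inE.
    - by move=> C CD; exact: Bx.
    - by exists A; split => // y Ay C CD; exact: (AD C CD).
  elim: s => [_ _|C s IH GC Cx].
    have [A GA Ax] : (\bigcup_(A in G) A) x by rewrite (cring_cover GP).
    by exists A; split.
  have [||A [GA Ax As]] := IH.
  - by move=> B Bs; apply: GC; rewrite in_cons Bs orbT.
  - by move=> B Bs; apply: Cx; rewrite in_cons Bs orbT.
  exists (A `&` C); split.
  - by apply: (cring_setI GP) => //; apply: GC; rewrite in_cons eqxx.
  - by split => //; apply: Cx; rewrite in_cons eqxx.
  - by move=> B; rewrite in_cons => /orP[/eqP -> y []//|/As AB y [/AB]].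
suff -> : U = \bigcup_(A in [set A | G A /\ A `<=` U]) A.
  suff H : [set \bigcup_(i in D') i | D' in subset^~ (finI_from G id)]
    (\bigcup_(A in [set A | G A /\ A `<=` U]) A) by [].
  eexists; last by reflexivity.
  by move=> A [GA _]; exact: (finI_from1 id GA).
apply/seteqP; split=> [x /GU[A [GA Ax AU]]|x [A [_ AU] /AU//]].
by exists A.
Qed.

Section Measure.
Context (R : realType) (K : fieldType) (v : K -> R) (X : choiceType).
Context (Rg : set (set X)) (mu : set X -> K).

Definition shrinking (F : set (set X)) : Prop :=
  forall A B, F A -> F B -> exists2 C, F C & C `<=` A `&` B.

(* mu is a total function, but only its values on Rg are ever used. *)
Record is_measure : Prop := {
  meas_additive : forall A B, Rg A -> Rg B -> A `&` B = set0 ->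
    mu (A `|` B) = mu A + mu B;
  meas_bounded : forall A, Rg A ->
    exists M : R, forall B, Rg B -> B `<=` A -> v (mu B) <= M;
  meas_continuous : forall F : set (set X), F `<=` Rg -> shrinking F ->
    \bigcap_(A in F) A = set0 ->
    forall e : R, 0 < e ->
      exists2 A0, F A0 & forall A, F A -> A `<=` A0 -> v (mu A) < e
}.

(* sup { |m B| : B in G, B included in A } *)
Definition sup_norm_on (G : set (set X)) (m : set X -> K) (A : set X) : \bar R :=
  ereal_sup [set (v (m B))%:E | B in [set B | G B /\ B `<=` A]].

Definition Nmu (x : X) : \bar R :=
  ereal_inf [set sup_norm_on Rg mu U | U in [set U | Rg U /\ U x]].

Definition X0 : set X := [set x | Nmu x = 0%E].

Definition fnorm (f : X -> K) : \bar R :=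
  ereal_sup [set ((v (f x))%:E * Nmu x)%E | x in setT].

Definition chi (A : set X) (x : X) : K := (x \in A)%:R.

(* A list of pairs (c, A) stands for the step function \sum c chi_A. *)
Definition is_step (s : seq (K * set X)) : Prop :=
  forall p, p \in s -> Rg p.2.

Definition step_fun (s : seq (K * set X)) (x : X) : K :=
  \sum_(p <- s) p.1 * chi p.2 x.

Definition step_integral (s : seq (K * set X)) : K :=
  \sum_(p <- s) p.1 * mu p.2.

Definition step_approx (f : X -> K) (s : nat -> seq (K * set X)) : Prop :=
  (forall n, is_step (s n)) /\
  (fun n => fnorm (fun x => step_fun (s n) x - f x)) @ \oo --> 0%E.

Definition is_integrable (f : X -> K) : Prop := exists s, step_approx f s.

(* Extension by continuity: the limit of the integrals of approximating step
   functions. It exists and is unique for f integrable, K being complete and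
   |integral f| being at most fnorm f for step functions; otherwise the value
   is arbitrary. *)
Definition integral_mu (f : X -> K) : K :=
  xget 0 [set l | exists2 s, step_approx f s &
    (fun n => v (step_integral (s n) - l)) @ \oo --> (0 : R)].

Definition Rmu : set (set X) := [set A | is_integrable (chi A)].

Definition mu_ext (A : set X) : K := integral_mu (chi A).

Definition set_norm (A : set X) : \bar R := sup_norm_on Rmu mu_ext A.

Definition is_probability_space : Prop := Rg setT /\ mu setT = 1.

Definition measure_preserving (T : X -> X) : Prop :=
  continuous (T : ring_topology Rmu -> ring_topology Rmu) /\
  (forall B, Rmu B -> mu_ext (T @^-1` B) = mu_ext B).

End Measure.

Definition log2 (R : realType) (n : nat) : R := ln n%:R / ln 2.

Section Families.
Context (X : choiceType).
Implicit Types (P Q : set (set X)) (T : X -> X).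

Definition family_join P Q : set (set X) := [set A `&` B | A in P & B in Q].

Definition family_preimage T P : set (set X) := [set T @^-1` A | A in P].

Definition finite_subalgebra (G P : set (set X)) : Prop :=
  [/\ finite_set P, P `<=` G, P setT,
      setI_closed P /\ setU_closed P & setD_closed P].

Definition algebra_partition P : set (set X) :=
  [set B | B !=set0 /\ exists s : set X -> bool,
     B = \bigcap_(C in P) (if s C then C else ~` C)].

(* The subalgebra with partition Z consists of the unions of members of Z. *)
Definition algebra_join P Q : set (set X) :=
  [set \bigcup_(B in Z) B |
    Z in [set Z | Z `<=` family_join (algebra_partition P)
                                     (algebra_partition Q)]].

(* P v T^-1 P v ... v T^-n P *)
Fixpoint algebra_iter T P (n : nat) : set (set X) :=
  if n is m.+1
  then algebra_join (algebra_iter T P m) (family_preimage (iter n T) P)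
  else P.

Fixpoint cover_iter T P (n : nat) : set (set X) :=
  if n is m.+1
  then family_join (cover_iter T P m) (family_preimage (iter n T) P)
  else P.

End Families.

Section MeasureEntropy.
Context (R : realType) (K : fieldType) (v : K -> R) (X : choiceType).
Context (Rg : set (set X)) (mu : set X -> K).
Local Notation norm := (set_norm v Rg mu).

Definition positive_part (a : set (set X)) : set (set X) :=
  [set A | a A /\ (0 < norm A)%E].

Definition H_mu (P : set (set X)) : \bar R :=
  let M := fset_set (positive_part (algebra_partition P)) in
  ((\big[mine/+oo]_(A <- M) norm A) * (log2 R #|` M|)%:E)%E.

Definition H_mu_seq (T : X -> X) (P : set (set X)) (n : nat) : \bar R :=
  ((n.+1%:R^-1)%:E * H_mu (algebra_iter T P n))%E.

(* The inverse image under T of a set of norm 0 may have positive norm, so that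
   this sequence need not converge. The upper limit is the limit whenever the
   latter exists, see [h_mu_algE]. *)
Definition h_mu_alg (T : X -> X) (P : set (set X)) : \bar R :=
  limn_esup (H_mu_seq T P).

Lemma h_mu_algE (T : X -> X) (P : set (set X)) :
  cvgn (H_mu_seq T P) -> h_mu_alg T P = limn (H_mu_seq T P).
Proof. exact: is_cvg_limn_esupE. Qed.

Definition h_mu (T : X -> X) : \bar R :=
  ereal_sup [set h_mu_alg T P | P in finite_subalgebra (Rmu v Rg mu)].

End MeasureEntropy.

Section TopologicalEntropy.
Context (R : realType) (Y : topologicalType).

Definition open_cover (U : set (set Y)) : Prop :=
  (forall A, U A -> open A) /\ \bigcup_(A in U) A = setT.

Definition subcover_card (U : set (set Y)) : set nat :=
  [set n | exists V : set (set Y),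
     [/\ V `<=` U, finite_set V, \bigcup_(A in V) A = setT
       & #|` fset_set V| = n]].

(* The least element of [subcover_card U], or 0 if no subcover is finite. *)
Definition cover_number (U : set (set Y)) : nat :=
  xget 0%N [set n | subcover_card U n /\
                    forall m, subcover_card U m -> (n <= m)%N].

Definition H_top (U : set (set Y)) : R := log2 R (cover_number U).

(* On a compact space, for T continuous and U an open cover, the limit exists by
   subadditivity. *)
Definition h_top_cover (T : Y -> Y) (U : set (set Y)) : \bar R :=
  limn (fun n => (n.+1%:R^-1 * H_top (cover_iter T U n))%:E).

Definition h_top (T : Y -> Y) : \bar R :=
  ereal_sup [set h_top_cover T U | U in open_cover].

End TopologicalEntropy.

(* Main.v *)
From HB Require Import structures.
Require Import Defs.
From mathcomp Require Import all_boot all_order all_algebra.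
From mathcomp Require Import finmap.
From mathcomp Require Import all_classical all_reals all_analysis.

(* The partition of P v T^-1 P v ... v T^-n P consists of the nonempty members of
   the iterated cover of the partition a of P, and these are pairwise disjoint;
   so the iterated cover has a single irredundant subcover, and its topological
   entropy is the logarithm of the number M of pieces. As norms are at most
   ||X|| = 1, H_mu is at most log M, whence h_mu(T, P) <= h_top(T, a); the limit
   on the right exists by Fekete's lemma.
   If all nonempty sets of R_mu have norm 1, then H_mu is exactly log M as soon as
   the pieces lie in R_mu. They do: T^-1 B is clopen, hence by compactness a finite
   union of members of R_mu. Finally every open cover is refined by the partition
   of a finite subalgebra, because the space is compact and R_mu is a base. *)

Set Implicit Arguments.
Unset Strict Implicit.
Unset Printing Implicit Defensive.

Import Order.TTheory GRing.Theory Num.Theory.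
Import numFieldNormedType.Exports.

Local Open Scope classical_set_scope.
Local Open Scope ring_scope.

(** * Logarithms of natural numbers and Fekete's subadditive lemma *)

Lemma log2_ge0 (R : realType) (n : nat) : 0 <= log2 R n.
Proof.
rewrite /log2; apply: divr_ge0; last by rewrite ln_ge0// ler1n.
by case: n => [|n]; [rewrite ln0|rewrite ln_ge0// ler1n].
Qed.

Lemma ler_log2 (R : realType) (m n : nat) : (m <= n)%N -> log2 R m <= log2 R n.
Proof.
case: m => [_|m mn]; first by rewrite {1}/log2 ln0// mul0r log2_ge0.
rewrite /log2 ler_pM2r ?invr_gt0 ?ln_gt0 ?ltr1n//.
by rewrite ler_ln ?ler_nat// posrE ltr0n// (leq_trans _ mn).
Qed.

(** For positive arguments this is an equality. The convention [ln 0 = 0] leaves only an inequality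
    when a factor is 0. *)
Lemma log2M_le (R : realType) (m n : nat) :
  log2 R (m * n) <= log2 R m + log2 R n.
Proof.
case: m n => [|m] [|n]; rewrite ?mul0n ?muln0;
  do 1?[by rewrite {1}/log2 ln0// mul0r addr_ge0// log2_ge0].
by rewrite /log2 natrM lnM ?posrE ?ltr0n// mulrDl.
Qed.

(** Here [b n] stands for the term of index [n.+1] of a subadditive sequence, hence the successor in
    the hypothesis. The limit is the infimum of the quotients: splitting off blocks of length [k.+1]
    bounds [b n] by [n.+1%:R * u k] plus a constant. *)
Lemma fekete_cvg (R : realType) (b : nat -> R) :
  (forall n, 0 <= b n) -> (forall m n, b (m + n).+1 <= b m + b n) ->
  cvgn (fun n => n.+1%:R^-1 * b n).
Proof.
move=> b_ge0 bD; pose u n := n.+1%:R^-1 * b n.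
have u_lb : has_lbound (range u).
  by exists 0 => _ [n _ <-]; rewrite /u mulr_ge0// invr_ge0.
have u_inf : has_inf (range u) by split; [exists (u 0%N), 0%N|].
have SnP n : 0 < n.+1%:R :> R by rewrite ltr0n.
apply/cvg_ex; exists (inf (range u)); apply/cvgrPdist_le => e e0.
have e2 : 0 < e / 2 by rewrite divr_gt0.
have [_ [k _ <-] uk] := inf_adherent e2 u_inf.
(* Since [b] is nonnegative, [C] dominates each [b n] with [n <= k], the remainders left once no
   further block can be split off. *)
pose C := \sum_(i < k.+1) b i.
have bk : b k = k.+1%:R * u k by rewrite /u mulVKf.
have b_le n : b n <= n.+1%:R * u k + C.
  elim/ltn_ind: n => n IH; have [nk|kn] := leqP n k.
    rewrite ler_wpDl//; first by rewrite mulr_ge0// mulr_ge0// invr_ge0.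
    rewrite /C (bigD1 (Ordinal (nk : (n < k.+1)%N)))//= lerDl.
    by rewrite sumr_ge0.
  have nE : n = (k + (n - k.+1)).+1 by rewrite -addSn subnKC.
  have nk : (n - k.+1 < n)%N by rewrite ltn_subrL/= (leq_trans _ kn).
  rewrite {1}nE (le_trans (bD _ _))// bk.
  rewrite (le_trans (lerD (lexx _) (IH _ nk)))// addrA -mulrDl -natrD.
  by rewrite [in X in _ <= X]nE addSn addnS.
near=> n.
have un_ge : inf (range u) <= u n by apply: ge_inf => //; exists n.
have un_le : u n <= u k + n.+1%:R^-1 * C.
  by rewrite /u ler_pdivrMl// mulrDr mulVKf// b_le.
have Cn : n.+1%:R^-1 * C <= e / 2.
  rewrite ler_pdivrMl// -ler_pdivrMr//.
  near: n; apply: filterS (nbhs_infty_ger (C / (e / 2))) => n /= Cn.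
  by rewrite (le_trans Cn)// ler_nat.
rewrite distrC ger0_norm ?subr_ge0// -/(u n).
by rewrite lerBlDl (splitr e) addrA (le_trans un_le)// lerD// ltW.
Unshelve. all: by end_near. Qed.

(** * Covers and their iterates *)

(** Finite subcovers are lists, so that joins and preimages are list operations. Repetitions are
    harmless for minimal cardinalities, as [undup] only shortens the list. *)
Definition subcover (Y : Type) (U : set (set Y)) (s : seq (set Y)) : Prop :=
  (forall A, A \in s -> U A) /\ (forall x, exists2 A, A \in s & A x).

Section Subcover.
Context (Y : topologicalType).
Implicit Types (U V : set (set Y)) (s t : seq (set Y)) (T : Y -> Y).

Lemma subcover_cardP U n : subcover_card U n <->
  exists s, [/\ subcover U s, uniq s & size s = n].
Proof.
split=> [[V [VU Vfin Vcov <-]]|[s [[sU scov] us <-]]].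
  exists (fset_set V); split; [split| exact: fset_uniq | by []].
    by move=> A; rewrite in_fset_set// inE => /VU.
  move=> x; have [A VA Ax] : (\bigcup_(A in V) A) x by rewrite Vcov.
  by exists A; rewrite // in_fset_set// inE.
have sE : [set` s] = [set` [fset A in s]%fset].
  by apply/seteqP; split=> A; rewrite /= inE.
exists [set` s]; split.
- by move=> A /sU.
- by rewrite sE.
- by rewrite -subTset => x _; have [A As Ax] := scov x; exists A.
- by rewrite sE set_fsetK card_fseq undup_id.
Qed.

Lemma subcover_undup U s : subcover U s -> subcover U (undup s).
Proof.
move=> [sU scov]; split=> [A|x]; first by rewrite mem_undup => /sU.
by have [A As Ax] := scov x; exists A; rewrite ?mem_undup.
Qed.

Lemma cover_number_spec U s : subcover U s ->
  subcover_card U (cover_number U) /\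
  forall m, subcover_card U m -> (cover_number U <= m)%N.
Proof.
move=> /subcover_undup Us.
have ex_n : exists n, `[<subcover_card U n>].
  by exists (size (undup s)); apply/asboolP/subcover_cardP; exists (undup s);
    rewrite undup_uniq.
have [n /asboolP Un n_min] := ex_minnP ex_n.
rewrite /cover_number; case: xgetP => [k _ //|/(_ n)[]].
by split=> // m Um; apply/n_min/asboolP.
Qed.

Lemma cover_number_le U s : subcover U s -> (cover_number U <= size s)%N.
Proof.
move=> Us; rewrite (leq_trans _ (size_undup s))//.
apply: (cover_number_spec Us).2; apply/subcover_cardP.
by exists (undup s); rewrite undup_uniq; split=> //; apply: subcover_undup.
Qed.

Lemma cover_number_attained U s : subcover U s ->
  exists2 t, subcover U t & size t = cover_number U.
Proof.
by move=> /cover_number_spec[/subcover_cardP[t [Ut _ tE]] _]; exists t.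
Qed.

Lemma subcover_join U V s t : subcover U s -> subcover V t ->
  subcover (family_join U V) [seq A `&` B | A <- s, B <- t].
Proof.
move=> [sU scov] [tV tcov]; split=> [_ /allpairsP[[A B] /= [As Bt ->]]|x].
  by exists A; [exact: sU|exists B; [exact: tV|]].
have [A As Ax] := scov x; have [B Bt Bx] := tcov x.
by exists (A `&` B) => //; apply/allpairsP; exists (A, B).
Qed.

Lemma subcover_preimage T U s : subcover U s ->
  subcover (family_preimage T U) [seq T @^-1` A | A <- s].
Proof.
move=> [sU scov]; split=> [_ /mapP[A /sU UA ->]|x]; first by exists A.
by have [A As Ax] := scov (T x); exists (T @^-1` A) => //; apply/mapP; exists A.
Qed.

Definition refines U V : Prop := forall A, U A -> exists2 B, V B & A `<=` B.

Lemma subcover_refines U V s : refines U V -> subcover U s ->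
  exists2 t, subcover V t & size t = size s.
Proof.
move=> UV [sU scov].
have [f fV] : {f : set Y -> set Y & forall A, U A -> V (f A) /\ A `<=` f A}.
  apply: (@choice _ _ (fun A B => U A -> V B /\ A `<=` B)) => A.
  have [/UV[B VB AB]|nUA] := pselect (U A); last by exists set0 => /nUA.
  by exists B.
exists (map f s); last by rewrite size_map.
split=> [_ /mapP[A /sU/fV[? _] ->] //|x].
have [A As Ax] := scov x; exists (f A); first by apply/mapP; exists A.
by have [_] := fV A (sU A As); exact.
Qed.

Lemma cover_number_refines U V s : refines U V -> subcover U s ->
  (cover_number V <= cover_number U)%N.
Proof.
move=> UV /cover_number_attained[t Ut <-].
by have [t' Vt' <-] := subcover_refines UV Ut; exact: cover_number_le.
Qed.

Lemma family_join_refines U U' V V' : refines U U' -> refines V V' ->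
  refines (family_join U V) (family_join U' V').
Proof.
move=> UU VV _ [A /UU[A' UA' AA] [B /VV[B' VB' BB] <-]].
by exists (A' `&` B'); [exists A' => //; exists B'|exact: setISS].
Qed.

Lemma family_preimage_refines T U V : refines U V ->
  refines (family_preimage T U) (family_preimage T V).
Proof.
move=> UV _ [A /UV[B VB AB] <-].
by exists (T @^-1` B); [exists B|exact: preimage_subset].
Qed.

Lemma cover_iter_refines T U V n : refines U V ->
  refines (cover_iter T U n) (cover_iter T V n).
Proof.
move=> UV; elim: n => //= n IH.
by apply: family_join_refines => //; exact: family_preimage_refines.
Qed.

Lemma subcover_iter T U s n : subcover U s ->
  exists t, subcover (cover_iter T U n) t.
Proof.
move=> Us; elim: n => [|n [t Ut]] /=; first by exists s.
by eexists; apply: subcover_join Ut _; exact: subcover_preimage Us.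
Qed.

Lemma family_joinA (U V W : set (set Y)) :
  family_join U (family_join V W) = family_join (family_join U V) W.
Proof.
apply/seteqP; split=> D.
  move=> [A UA [_ [B VB [C WC <-]] <-]]; exists (A `&` B).
    by exists A => //; exists B.
  by exists C => //; rewrite setIA.
move=> [_ [A UA [B VB <-]] [C WC <-]]; exists A => //.
by exists (B `&` C); [exists B => //; exists C|rewrite setIA].
Qed.

Lemma family_preimage_join T U V : family_preimage T (family_join U V) =
  family_join (family_preimage T U) (family_preimage T V).
Proof.
apply/seteqP; split=> D.
  move=> [_ [A UA [B VB <-]] <-]; exists (T @^-1` A); first by exists A.
  by exists (T @^-1` B) => //; exists B.
move=> [_ [A UA <-] [_ [B VB <-] <-]]; exists (A `&` B) => //.
by exists A => //; exists B.
Qed.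

Lemma family_preimage_comp (S T : Y -> Y) U :
  family_preimage T (family_preimage S U) = family_preimage (S \o T) U.
Proof.
apply/seteqP; split=> D; first by move=> [_ [A UA <-] <-]; exists A.
by move=> [A UA <-]; exists (S @^-1` A) => //; exists A.
Qed.

(** [cover_iter T U n] joins [n.+1] covers. The [m + n + 2] covers on the left split into the first
    [m.+1] and the remaining [n.+1], which are pulled back by [iter m.+1 T]. *)
Lemma cover_iterD T U m n : cover_iter T U (m + n).+1 =
  family_join (cover_iter T U m)
              (family_preimage (iter m.+1 T) (cover_iter T U n)).
Proof.
elim: n => [|n IH]; first by rewrite addn0.
have -> : cover_iter T U (m + n.+1).+1 = family_join (cover_iter T U (m + n).+1)
    (family_preimage (iter (m + n).+2 T) U) by rewrite addnS.
rewrite IH [cover_iter T U n.+1]/= family_preimage_join family_joinA.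
congr family_join; rewrite family_preimage_comp; congr family_preimage.
by apply/funext => x; rewrite /comp -iterD addSn addnS addnC.
Qed.

(** Minimal subcovers of the two parts, intersected pairwise, give a subcover whose size is the
    product. The indices are those that [fekete_cvg] expects. *)
Lemma H_top_iterD (R : realType) T U s m n : subcover U s ->
  H_top R (cover_iter T U (m + n).+1) <=
  H_top R (cover_iter T U m) + H_top R (cover_iter T U n).
Proof.
move=> Us; rewrite /H_top (le_trans _ (log2M_le _ _ _))// ler_log2//.
have [t /cover_number_attained[t1 Ut1 <-]] := subcover_iter T m Us.
have [t' /cover_number_attained[t2 Ut2 <-]] := subcover_iter T n Us.
rewrite -[in leqRHS](size_map (preimage (iter m.+1 T)) t2).
rewrite -(size_allpairs (@setI Y)).
rewrite cover_iterD; apply: cover_number_le; apply: subcover_join => //.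
exact: subcover_preimage.
Qed.

Lemma is_cvg_h_top_cover (R : realType) T U s : subcover U s ->
  cvgn (fun n => (n.+1%:R^-1 * H_top R (cover_iter T U n))%:E).
Proof.
move=> Us; suff : cvgn (fun n => n.+1%:R^-1 * H_top R (cover_iter T U n)).
  move=> /cvg_ex[l ul]; apply/cvg_ex; exists l%:E.
  by apply: cvg_EFin => //; exact: nearW.
apply: fekete_cvg => [n|m n]; first exact: log2_ge0.
exact: H_top_iterD Us.
Qed.

End Subcover.

(** * Finite algebras and their partitions *)

Section Atoms.
Context (X : choiceType).
Implicit Types (P Q : set (set X)) (T : X -> X).

(** The class of [x] for the relation of lying in the same members of [P]. A cell is thus named by
    any of its points instead of a choice of signs. *)
Definition atom P (x : X) : set X := [set y | forall C, P C -> C x <-> C y].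

Lemma atom_eq P x y : atom P x y -> atom P x = atom P y.
Proof. by move=> xy; apply/seteqP; split=> z xz C PC; rewrite -xz// xy. Qed.

Lemma algebra_partitionE P : algebra_partition P = range (atom P).
Proof.
apply/seteqP; split=> [B [[x Bx] [s BE]] | _ [x _ <-]].
  rewrite BE in Bx *.
  exists x => //; apply/seteqP; split=> y xy C PC.
    by have := Bx C PC; have := xy C PC; case: (s C) => //;
      rewrite /setC/=; tauto.
  by have := Bx C PC; have := xy C PC; case: (s C) => //;
      rewrite /setC/=; tauto.
split; first by exists x.
exists (fun C => `[<C x>]); apply/seteqP; split=> y xy C PC.
  by have := xy _ PC; case: asboolP => /= ?; rewrite /setC/=; tauto.
by have := xy _ PC; case: asboolP => /= ?; rewrite /setC/=; tauto.
Qed.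

(** The members of the join are unions of cells [atom P z]&[atom Q z], and each such cell is itself
    a member, so the join separates exactly the points that [P] or [Q] separates. *)
Lemma atom_join P Q x : atom (algebra_join P Q) x = atom P x `&` atom Q x.
Proof.
have PQx z : family_join (algebra_partition P) (algebra_partition Q)
    (atom P z `&` atom Q z).
  by rewrite !algebra_partitionE; exists (atom P z) => //; exists (atom Q z).
apply/seteqP; split=> [y xy|y [Pxy Qxy] _ [Z ZPQ <-]].
  have C_in : algebra_join P Q (atom P x `&` atom Q x).
    by exists [set atom P x `&` atom Q x]; [move=> _ ->|rewrite bigcup_set1].
  by apply: (xy _ C_in).1.
(* A cell is determined by any point in it, so membership in a union of cells is the same for [x]
   and [y]. *)
have ZE D z : Z D -> D z -> D = atom P z `&` atom Q z.
  move=> /ZPQ[A + [B + <-]] [Az Bz]; rewrite !algebra_partitionE.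
  by move=> [a _ aA] [b _ bB]; rewrite -aA -bB in Az Bz *;
    rewrite (atom_eq Az) (atom_eq Bz).
split=> -[D ZD Dz]; exists D => //; rewrite (ZE D _ ZD Dz); first by split.
by rewrite -(atom_eq Pxy) -(atom_eq Qxy).
Qed.

Lemma atom_preimage T P x :
  atom (family_preimage T P) x = T @^-1` atom P (T x).
Proof.
apply/seteqP; split=> y xy; last by move=> _ [C PC <-]; exact: (xy C PC).
by move=> C PC; apply: (xy (T @^-1` C)); exists C.
Qed.

(** Intersections of cells can be empty: these stay in the iterated cover but are no cells of the
    iterated algebra. *)
Lemma algebra_partition_iter T P n : algebra_partition (algebra_iter T P n) =
  cover_iter T (algebra_partition P) n `&` [set A | A !=set0].
Proof.
elim: n => [|n IH] /=.
  by apply/seteqP; split=> [A PA|A []//]; split=> //; case: PA.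
rewrite [LHS]algebra_partitionE; apply/seteqP; split=> [_ [x _ <-]|D].
  rewrite atom_join atom_preimage; split; last by exists x.
  have : algebra_partition (algebra_iter T P n) (atom (algebra_iter T P n) x).
    by rewrite algebra_partitionE.
  rewrite IH => -[Cx _]; eexists; first exact: Cx.
  eexists; last by reflexivity.
  eexists; last by reflexivity.
  by rewrite algebra_partitionE; eexists.
move=> [[A CA [_ [B PB <-] <-]] [x [Ax Bx]]]; exists x => //.
rewrite atom_join atom_preimage.
have : algebra_partition (algebra_iter T P n) A.
  by rewrite IH; split=> //; exists x.
move: PB; rewrite !algebra_partitionE => -[b _ bB] [a _ aA].
move: Ax Bx; rewrite -aA -bB => Ax Bx.
by rewrite (atom_eq Ax) (atom_eq Bx).
Qed.

Lemma algebra_partition_disjoint P A B x : algebra_partition P A ->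
  algebra_partition P B -> A x -> B x -> A = B.
Proof.
rewrite algebra_partitionE => -[a _ <-] [b _ <-] ax bx.
by rewrite (atom_eq ax) (atom_eq bx).
Qed.

Lemma finite_subalgebra_sub G P : finite_subalgebra G P ->
  algebra_partition P `<=` P.
Proof.
move=> [Pfin _ PT [PI _] PD] _ [_ [s ->]].
rewrite -[X in P (\bigcap_(C in X) _)](fset_setK Pfin) bigcap_seq big_seq.
elim/big_ind: _ => [//|A B|C]; first exact: PI.
rewrite in_fset_set// inE => PC.
by case: (s C) => //; rewrite -setTD; exact: PD.
Qed.

Lemma subcover_algebra_partition G P : finite_subalgebra G P ->
  subcover (algebra_partition P) (fset_set (algebra_partition P)).
Proof.
move=> PP; have Afin : finite_set (algebra_partition P).
  by apply: sub_finite_set (finite_subalgebra_sub PP) _; case: PP.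
split=> [A|x]; first by rewrite in_fset_set// inE.
exists (atom P x) => //; rewrite in_fset_set// inE algebra_partitionE.
by exists x.
Qed.

End Atoms.

(** A point of a nonempty member lies in no other member, so every subcover contains all nonempty
    members; these already cover. *)
Lemma cover_number_disjoint (Y : topologicalType) (U : set (set Y)) s
    (N := U `&` [set A | A !=set0]) :
  (forall A B x, N A -> N B -> A x -> B x -> A = B) -> subcover U s ->
  finite_set N /\ cover_number U = #|` fset_set N|.
Proof.
move=> Ndisj Us.
have N_sub t : subcover U t -> {subset N <= t}.
  move=> [tU tcov] A; rewrite inE => -[UA [x Ax]].
  have [B Bt Bx] := tcov x.
  by rewrite (Ndisj A B x)//; split=> //; [exists x|exact: tU|exists x].
have Nfin : finite_set N.
  apply: (@sub_finite_set _ _ [set` s]) => [A NA|]; last exact: finite_seq.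
  by apply: N_sub Us _ _; rewrite inE.
split=> //; apply/eqP; rewrite eqn_leq; apply/andP; split.
  apply: cover_number_le; split=> [A|x].
    by rewrite in_fset_set// inE => -[].
  have [A As Ax] := Us.2 x; exists A => //; rewrite in_fset_set// inE.
  by split; [exact: Us.1|exists x].
have [t Ut <-] := cover_number_attained Us.
apply: uniq_leq_size; first exact: fset_uniq.
by move=> A; rewrite in_fset_set//; exact: N_sub.
Qed.

Lemma compact_subcover (Y : topologicalType) (U : set (set Y)) :
  compact [set: Y] -> open_cover U -> exists s, subcover U s.
Proof.
move=> + [Uop Ucov].
have [/set0P[y _]|Y0] := pselect ([set: Y] != set0); last first.
  move=> _; exists [::]; split=> // x; exfalso.
  by apply: Y0; apply/set0P; exists x.
(* [compact_cover] is only available on pointed topological spaces *)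
pose Y' : ptopologicalType :=
  HB.pack (Topological.sort Y) (isPointed.Build Y y).
move=> Yc; have {}Yc : @cover_compact Y' [set: Y'] by rewrite -compact_cover.
have [|D' D'U D'cov] := Yc _ U id Uop.
  by move=> x _; have : (\bigcup_(A in U) A) x by rewrite Ucov.
exists D'; split=> [A /D'U|x]; first by rewrite inE.
by have [A AD' Ax] := D'cov x I; exists A.
Qed.

(** * Sets with integrable indicator function *)

(* Covers at once the level sets of step functions and the sets determined by
   membership in the members of s. *)
Lemma covering_ring_foldr (X : choiceType) (G : set (set X)) (I : eqType)
    (V : Type) (A : I -> set X) (h : I -> bool -> V -> V) (v0 : V)
    (s : seq I) (S : set V) :
  covering_ring G -> G setT -> (forall i, i \in s -> G (A i)) ->
  G [set x | S (foldr (fun i => h i (x \in A i)) v0 s)].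
Proof.
move=> [_ GI GU GD _] GT; elim: s S => [|i s IH] S GA /=.
  have [Sv|nSv] := pselect (S v0).
    by rewrite (_ : mkset _ = setT)//; apply/seteqP; split.
  rewrite (_ : mkset _ = setT `\` setT); first exact: GD.
  by rewrite setDv; apply/seteqP; split.
have GAi : G (A i) by apply: GA; rewrite mem_head.
have GAs j : j \in s -> G (A j).
  by move=> js; apply: GA; rewrite in_cons js orbT.
(* According to membership in [A i], the condition [S] is pulled back along [h i true] or
   [h i false]; the induction hypothesis holds for every [S]. *)
rewrite (_ : mkset _ =
  (A i `&` [set x | (h i true @^-1` S) (foldr (fun i => h i (x \in A i)) v0 s)])
  `|` ([set x | (h i false @^-1` S) (foldr (fun i => h i (x \in A i)) v0 s)]
       `\` A i)).
  by apply: GU; [apply: GI => //; apply: IH|apply: GD => //; apply: IH].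
apply/seteqP; split=> x /=.
  case: (boolP (x \in A i)); rewrite ?inE => Aix Sx; first by left.
  by right; split=> // /mem_set; apply/negP.
by case=> -[]; [move=> ? ?; rewrite mem_set|move=> ? ?; rewrite memNset].
Qed.

Section Rmu.
Context (R : realType) (K : fieldType) (v : K -> R) (X : choiceType).
Context (Rg : set (set X)) (mu : set X -> K) (x0 : X).
Hypotheses (Kabs : nonarchimedean_abs v) (Rg_ring : covering_ring Rg).
Hypothesis RgT : Rg setT.
Local Notation N := (Nmu v Rg mu).
Local Notation Rm := (Rmu v Rg mu).

Let v_ge0 x : 0 <= v x. Proof. exact: nabs_ge0. Qed.
Let v0 : v 0 = 0. Proof. by apply/(nabs_eq0 Kabs). Qed.

Let v1 : v 1 = 1.
Proof.
have v1_neq0 : v 1 != 0.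
  by apply/eqP => /(nabs_eq0 Kabs)/eqP; rewrite oner_eq0.
by apply: (mulfI v1_neq0); rewrite -(nabsM Kabs) !mulr1.
Qed.

Let vN x : v (- x) = v x.
Proof.
have vN1 : v (- 1) = 1.
  by apply/eqP; rewrite -(eqrXn2 (n := 2))// expr2 -(nabsM Kabs) mulrNN mulr1 v1
    expr1n.
by rewrite -mulN1r (nabsM Kabs) vN1 mul1r.
Qed.

Lemma Nmu_ge0 x : (0 <= N x)%E.
Proof.
apply: le_ereal_inf_tmp => _ [U [RgU _] <-].
apply: (@le_trans _ _ (v (mu set0))%:E); first by rewrite lee_fin.
apply: ereal_sup_ubound; exists set0 => //; split=> //.
by rewrite -(setDv U); exact: (cring_setD Rg_ring).
Qed.

Lemma step_fun_preimage s (S : set K) : is_step Rg s ->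
  Rg [set x | S (step_fun s x)].
Proof.
move=> sRg.
rewrite (_ : step_fun s =
  fun x => foldr (fun p => (fun b y => p.1 * b%:R + y) (x \in p.2)) 0 s).
  exact: (covering_ring_foldr (A := fun p : K * set X => p.2)
    (fun p (b : bool) y => p.1 * b%:R + y) 0 S Rg_ring RgT sRg).
apply/funext => x; rewrite /step_fun.
by elim: (s) => [|p s' IH]; rewrite ?big_nil// big_cons IH.
Qed.

(* If g is a step function and B = {|g - 1| < 1}, then |g - chi_A| >= 1 on the
   symmetric difference of A and B, by the ultrametric inequality: step functions
   approximating chi_A can be replaced by members of the ring. *)
Lemma Rmu_approxP A : Rm A <-> forall e : R, 0 < e ->
  exists2 B, Rg B & forall x, (x \in B) != (x \in A) -> (N x <= e%:E)%E.
Proof.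
split=> [[s [sRg scvg]] e e0|A_approx].
  have /scvg [n _ /(_ n (leqnn n)) /= se] : nbhs 0%E [set y | (y < e%:E)%E].
    apply: open_nbhs_nbhs; split; first exact: open_ereal_lt_ereal.
    by rewrite /= lte_fin.
  exists [set x | v (step_fun (s n) x - 1) < 1].
    exact: (step_fun_preimage (fun y => v (y - 1) < 1)).
  move=> x xAB; apply/ltW/(le_lt_trans _ se).
  apply: (@le_trans _ _ ((v (step_fun (s n) x - chi K A x)%R)%:E * N x)%E);
    last by apply: ereal_sup_ubound; exists x.
  apply: lee_pemull; [exact: Nmu_ge0|rewrite lee_fin].
  have xBE : (x \in [set x | v (step_fun (s n) x - 1) < 1]) =
      (v (step_fun (s n) x - 1) < 1) by apply/idP/idP; rewrite inE.
  move: xAB; rewrite xBE /chi; case: (x \in A); first by case: ltP.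
  (* Outside [A], having both |g| < 1 and |g - 1| < 1 would give |1| < 1. *)
  case: ltP => // vx _; rewrite subr0 leNgt; apply/negP => vx1.
  have := nabsD Kabs (step_fun (s n) x) (- (step_fun (s n) x - 1)).
  by rewrite opprB addrC subrK v1 leNgt gt_max vx1/= -opprB vN vx.
have [B BP] : {B : nat -> set X & forall n, Rg (B n) /\ forall x,
    (x \in B n) != (x \in A) -> (N x <= (n.+1%:R^-1)%:E)%E}.
  apply: (@choice _ _ (fun n B => Rg B /\ forall x,
    (x \in B) != (x \in A) -> (N x <= (n.+1%:R^-1)%:E)%E)) => n.
  have [|B RgB NB] := A_approx n.+1%:R^-1; first by rewrite invr_gt0.
  by exists B.
exists (fun n => [:: (1, B n)]); split.
  by move=> n p; rewrite inE => /eqP ->; case: (BP n).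
apply: (@squeeze_cvge _ _ _ _ (fun=> 0%E) _ (fun n => (n.+1%:R^-1)%:E)).
(* The point [x0] makes the supremum in [fnorm] range over a nonempty set, hence nonnegative. *)
- apply: nearW => n; apply/andP; split.
    apply: (@le_trans _ _
      ((v (step_fun [:: (1, B n)] x0 - chi K A x0)%R)%:E * N x0)%E).
      by rewrite mule_ge0 ?lee_fin ?Nmu_ge0.
    by apply: ereal_sup_ubound; exists x0.
  apply: ge_ereal_sup => _ [x _ <-].
  rewrite /step_fun big_seq1 mul1r /chi /=.
  have [xAB|/(BP n).2] := eqVneq (x \in B n) (x \in A).
    by rewrite xAB subrr v0 mul0e lee_fin invr_ge0.
  case: (x \in B n); case: (x \in A); rewrite ?subrr ?subr0 ?sub0r ?vN ?v0 ?v1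
    ?mul1e ?mul0e// => _; by rewrite lee_fin invr_ge0.
- exact: cvg_cst.
- by apply: cvg_EFin; [exact: nearW|exact: cvg_harmonic].
Qed.

Lemma sub_Rmu A : Rg A -> Rm A.
Proof.
by move=> RgA; apply/Rmu_approxP => e e0; exists A => // x; rewrite eqxx.
Qed.

(** Where the approximations agree with [A] and with [B], so do their combinations. A bad point is
    thus bad for one operand, and the bound [e] passes on unchanged. *)
Lemma Rmu_op (op : set X -> set X -> set X) (b : bool -> bool -> bool) :
  (forall A B x, (x \in op A B) = b (x \in A) (x \in B)) ->
  (forall A B, Rg A -> Rg B -> Rg (op A B)) ->
  forall A B, Rm A -> Rm B -> Rm (op A B).
Proof.
move=> opE Rgop A B /Rmu_approxP RA /Rmu_approxP RB; apply/Rmu_approxP => e e0.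
have [A' RgA NA] := RA e e0; have [B' RgB NB] := RB e e0.
exists (op A' B') => [|x]; first exact: Rgop.
rewrite !opE; have [-> /=|/NA //] := eqVneq (x \in A') (x \in A).
by have [->|/NB //] := eqVneq (x \in B') (x \in B); rewrite eqxx.
Qed.

Lemma Rmu_setT : Rm setT.
Proof. exact: sub_Rmu. Qed.

Lemma covering_ring_Rmu : covering_ring Rm.
Proof.
split.
- by rewrite -subTset => x _; exists setT => //; exact: Rmu_setT.
- apply: (Rmu_op (b := andb)) (cring_setI Rg_ring) => A B x; exact: in_setI.
- apply: (Rmu_op (b := orb)) (cring_setU Rg_ring) => A B x; exact: in_setU.
- apply: (Rmu_op (b := fun a b => a && ~~ b)) (cring_setD Rg_ring) => A B x.
  exact: in_setD.
- move=> x y /(cring_separating Rg_ring)[A [RgA Ax Ay]].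
  by exists A; split=> //; exact: sub_Rmu.
Qed.

End Rmu.

(** * Compactness in the topology of a covering ring *)

Section RingTopology.
Context (X : choiceType) (G : set (set X)).
Hypotheses (G_ring : covering_ring G) (GT : G setT).
Local Notation Y := (ring_topology G).

Lemma open_ring A : G A -> open (A : set Y).
Proof. by move=> GA; apply/open_ring_topologyP => // x Ax; exists A; split. Qed.

Lemma compact_ring_refines (U : set (set Y)) :
  compact [set: Y] -> open_cover U -> exists2 s : seq (set X),
    subcover G s & forall A, A \in s -> exists2 B, U B & A `<=` B.
Proof.
move=> Yc [Uop Ucov].
pose V : set (set Y) := [set A | G A /\ exists2 B, U B & A `<=` B].
have [|s [sV scov]] := compact_subcover (U := V) Yc.
  split=> [A [GA _]|]; first exact: open_ring.
  rewrite -subTset => x _.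
  have [B UB Bx] : (\bigcup_(A in U) A) x by rewrite Ucov.
  have [A [GA Ax AB]] := (open_ring_topologyP B G_ring).1 (Uop _ UB) x Bx.
  by exists A => //; split=> //; exists B.
exists s; last by move=> A /sV[].
by split=> // A /sV[].
Qed.

Lemma compact_clopen_ring (A : set Y) : compact [set: Y] ->
  open A -> open (~` A) -> G A.
Proof.
move=> Yc Aop nAop.
(* Each ring member in the list [s] lies inside [A] or inside its complement; the former ones have
   union [A]. *)
have [|s [sG scov] sA] := compact_ring_refines (U := [set A; ~` A]) Yc.
  by split=> [B [] ->//|]; rewrite bigcup_setU1 bigcup_set1 setUv.
have -> : A = \big[setU/set0]_(B <- s | `[<B `<=` A>]) B.
  rewrite -bigcup_seq_cond; apply/seteqP.
  split=> [x Ax|x [B /= /andP[_ /asboolP BA]]].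
    have [B Bs Bx] := scov x; exists B => //=; rewrite Bs/=; apply/asboolP.
    by have [_ [->//|-> BA]] := sA B Bs; case: (BA x Bx).
  exact: BA.
rewrite big_seq_cond; elim/big_ind: _ => [|B C|B /andP[/sG]//].
  by rewrite -(setDv setT); exact: (cring_setD G_ring).
exact: (cring_setU G_ring).
Qed.

Lemma preimage_ring (T : Y -> Y) A : compact [set: Y] -> continuous T ->
  G A -> G (T @^-1` A).
Proof.
move=> Yc /continuousP Tc GA; apply: compact_clopen_ring => //.
  by apply: Tc; exact: open_ring.
rewrite preimage_setC; apply/Tc/open_ring; rewrite -setTD.
exact: (cring_setD G_ring).
Qed.

Lemma cover_iter_ring (T : Y -> Y) P n : compact [set: Y] -> continuous T ->
  P `<=` G -> cover_iter T P n `<=` G.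
Proof.
move=> Yc Tc PG; have TG k A : G A -> G (iter k T @^-1` A).
  by elim: k A => // k IH A GA; apply: (IH (T @^-1` A)); exact: preimage_ring.
elim: n => // n IH _ [A /IH GA [_ [B /PG GB <-] <-]].
by apply: (cring_setI G_ring) => //; exact: TG n.+1 _ GB.
Qed.

(* The algebra generated by a finite subfamily s consists of the preimages under
   the trace map x |-> (A |-> x \in A) into the finite type of 0-1 words. *)
Lemma finite_subalgebra_refines (s : seq (set X)) : subcover G s ->
  exists2 P, finite_subalgebra G P &
    forall A, algebra_partition P A -> exists2 B, B \in s & A `<=` B.
Proof.
move=> [sG scov]; pose tr (x : X) : (size s).-tuple bool :=
  map_tuple (fun A => x \in A) (in_tuple s).
pose P := [set tr @^-1` [set` S] | S in [set: {set (size s).-tuple bool}]].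
(* Every set of words is finite, so Boolean operations on [P] reduce to those on sets of words. *)
have PE (S : set ((size s).-tuple bool)) : P (tr @^-1` S).
  exists [set t | t \in S]%SET => //.
  by apply/seteqP; split=> x /=; rewrite !inE.
exists P.
  split.
  - exact: finite_image.
  - move=> _ [S _ <-].
    have := covering_ring_foldr (A := fun A : set X => A) (fun _ => cons) [::]
       [set t | t \in map val (enum S)] G_ring GT sG.
    have foldrE x : foldr (fun A => cons (x \in A)) [::] s = val (tr x).
      by rewrite /=; elim: (s) => //= A s' ->.
    congr G; apply/seteqP; split=> x /=; rewrite foldrE mem_map ?mem_enum//;
      exact: val_inj.
  - exact: (PE setT).
  - by split=> _ _ [S _ <-] [S' _ <-];
      [exact: (PE ([set` S] `&` [set` S']))
      |exact: (PE ([set` S] `|` [set` S']))].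
  - by move=> _ _ [S _ <-] [S' _ <-]; exact: (PE ([set` S] `\` [set` S'])).
move=> A; rewrite algebra_partitionE => -[x _ <-].
have [B Bs Bx] := scov x; exists B => // y xy.
(* The preimage of the single word [tr x] is a member of [P], so a cell has constant trace; the
   entry at the index of [B] then decides membership in [B]. *)
have trxy : tr y = tr x by have [+ _] := xy _ (PE [set tr x]); exact.
have /(congr1 (fun w : seq bool => nth false w (index B s))) := congr1 val trxy.
rewrite /= !(nth_map set0) ?index_mem// nth_index// => yBxB.
by apply/set_mem; rewrite yBxB inE.
Qed.

End RingTopology.

(** * Measure entropy and the number of pieces *)

Section MeasureEntropyBounds.
Context (R : realType) (K : fieldType) (v : K -> R) (X : choiceType).
Context (Rg : set (set X)) (mu : set X -> K).
Local Notation norm := (set_norm v Rg mu).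
Local Notation Y := (ring_topology (Rmu v Rg mu)).
Implicit Types (P : set (set X)).

Lemma set_norm_le (A B : set X) : A `<=` B -> (norm A <= norm B)%E.
Proof.
move=> AB; apply: ereal_sup_le => _ [C [RC CA] <-].
by exists C => //; split=> //; exact: subset_trans AB.
Qed.

Lemma H_mu_le P : norm setT = 1%E -> finite_set (algebra_partition P) ->
  (H_mu v Rg mu P <= (log2 R #|` fset_set (algebra_partition P)|)%:E)%E.
Proof.
move=> normT Pfin; rewrite /H_mu; set M := fset_set _.
have MP : finite_set (positive_part v Rg mu (algebra_partition P)).
  by apply: sub_finite_set Pfin => A [].
(* If no piece has positive norm, the minimum is [+oo], but [log2 R 0 = 0] and the product is 0. *)
have [->|[A AM]] := fset_0Vmem M.
  by rewrite big_seq_fset0 cardfs0 {1}/log2 ln0// mul0r mule0 lee_fin log2_ge0.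
apply: (@le_trans _ _ (1 * (log2 R #|` M|)%:E)%E).
  apply: lee_wpmul2r; first by rewrite lee_fin log2_ge0.
  by apply: (bigmin_inf_seq _ A) => //; rewrite -normT; exact: set_norm_le.
rewrite mul1e lee_fin; apply/ler_log2/fsubset_leq_card.
by rewrite -fset_set_sub// => B [].
Qed.

Lemma H_mu_eq P : (forall A, algebra_partition P A -> norm A = 1%E) ->
  finite_set (algebra_partition P) ->
  H_mu v Rg mu P = (log2 R #|` fset_set (algebra_partition P)|)%:E.
Proof.
move=> norm1 Pfin; rewrite /H_mu.
have -> : positive_part v Rg mu (algebra_partition P) = algebra_partition P.
  by apply/seteqP; split=> [A []//|A PA]; split=> //; rewrite norm1// lte01.
set M := fset_set _; have [->|[A AM]] := fset_0Vmem M.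
  by rewrite big_seq_fset0 cardfs0 /log2 ln0// mul0r mule0.
have M1 B : B \in M -> norm B = 1%E by rewrite in_fset_set// inE => /norm1.
suff -> : \big[mine/+oo%E]_(B <- M) norm B = 1%E by rewrite mul1e.
apply/le_anti/andP; split.
  by apply: (bigmin_inf_seq _ A) => //; rewrite M1.
by rewrite big_seq; apply: le_bigmin => [|B /M1 ->//]; rewrite leey.
Qed.

(** By [algebra_partition_iter] the pieces are the nonempty members of the iterated cover, and they
    are disjoint, so [cover_number_disjoint] counts them. *)
Lemma H_top_partition (T : Y -> Y) P n : finite_subalgebra (Rmu v Rg mu) P ->
  finite_set (algebra_partition (algebra_iter T P n)) /\
  H_top R (cover_iter T (algebra_partition P : set (set Y)) n) =
    log2 R #|` fset_set (algebra_partition (algebra_iter T P n))|.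
Proof.
move=> Palg; rewrite algebra_partition_iter /H_top.
have [s Ps] := subcover_iter (Y := Y) T n (subcover_algebra_partition Palg).
have [|Pfin ->] := cover_number_disjoint _ Ps; last by [].
by rewrite -algebra_partition_iter => A B x; exact: algebra_partition_disjoint.
Qed.

End MeasureEntropyBounds.

Lemma le_limn_esup (R : realType) (u w : nat -> \bar R) :
  (forall n, (u n <= w n)%E) -> (limn_esup u <= limn_esup w)%E.
Proof.
move=> uw; apply: le_ereal_inf_tmp => _ [V FV <-].
apply: ge_ereal_inf; exists (ereal_sup (u @` V)); first by exists V.
apply: ge_ereal_sup => _ [n Vn <-]; apply: (le_trans (uw n)).
by apply: ereal_sup_ubound; exists n.
Qed.

Theorem theorem4p16 (R : realType) (K : fieldType) (v : K -> R)
    (X : choiceType) (Rg : set (set X)) (mu : set X -> K) (T : X -> X)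
    (Kabs : nonarchimedean_abs v) (Kcomplete : abs_complete v)
    (Rg_ring : covering_ring Rg) (mu_meas : is_measure v Rg mu)
    (X_prob : is_probability_space Rg mu)
    (X_compact : compact [set: ring_topology (Rmu v Rg mu)])
    (X_norm1 : set_norm v Rg mu setT = 1%E)
    (T_mp : measure_preserving v Rg mu T) :
  (h_mu v Rg mu T <= h_top R (T : ring_topology (Rmu v Rg mu) -> _))%E /\
  (X0 v Rg mu = set0 ->
   (forall A : set X, A !=set0 -> Rmu v Rg mu A -> set_norm v Rg mu A = 1%E) ->
   h_mu v Rg mu T = h_top R (T : ring_topology (Rmu v Rg mu) -> _)).
Proof.
pose Y := ring_topology (Rmu v Rg mu); pose TY : Y -> Y := T.
have [[RgT muT] [T_cont _]] := (X_prob, T_mp).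
(* Additivity gives [mu set0 = 0], which excludes [setT = set0] because [mu setT = 1]. *)
have [x0 _] : [set: X] !=set0.
  apply/set0P/eqP => X0; have Rg0 : Rg set0 by rewrite -X0.
  have := meas_additive mu_meas Rg0 Rg0 (setI0 _); rewrite setU0 -X0 muT.
  by move/eqP; rewrite -subr_eq subrr eq_sym oner_eq0.
have Rm_ring : covering_ring (Rmu v Rg mu) by exact: covering_ring_Rmu x0 _ _ _.
have RmT : Rmu v Rg mu setT by exact: Rmu_setT x0 _ _ _.
have cvg_top P : finite_subalgebra (Rmu v Rg mu) P ->
    cvgn (fun n => (n.+1%:R^-1 *
      H_top R (cover_iter TY (algebra_partition P) n))%:E).
  move=> Palg; have Pcov := subcover_algebra_partition Palg.
  exact: (is_cvg_h_top_cover (Y := Y) Pcov).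
have le_top : (h_mu v Rg mu T <= h_top R TY)%E.
  apply: ge_ereal_sup => _ [P Palg <-].
  apply: (@le_trans _ _ (h_top_cover R TY (algebra_partition P))).
    (* The topological limit exists, so it is turned into an upper limit and compared termwise with
       that of the measure entropies. *)
    rewrite /h_top_cover -is_cvg_limn_esupE; last exact: cvg_top.
    apply: le_limn_esup => n; have [Pfin ->] := H_top_partition TY n Palg.
    by rewrite /H_mu_seq EFinM lee_wpmul2l ?lee_fin ?invr_ge0//; exact: H_mu_le.
  apply: ereal_sup_ubound; exists (algebra_partition P) => //; split.
    move=> A /(finite_subalgebra_sub Palg) PA; apply: open_ring => //.
    by case: Palg => _ PR _ _ _; exact: PR.
  have [sP cov] := subcover_algebra_partition Palg.
  by rewrite -subTset => x _; have [A /sP PA Ax] := cov x; exists A.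
split=> // _ norm1; apply/eqP; rewrite eq_le le_top/=.
apply: ge_ereal_sup => _ [U Uop <-].
have [s sRm sU] := compact_ring_refines Rm_ring X_compact Uop.
have [P Palg Ps] := finite_subalgebra_refines Rm_ring RmT sRm.
have PU : refines (algebra_partition P : set (set Y)) U.
  move=> A /Ps[B /sU[C UC BC] AB]; exists C => //; exact: subset_trans BC.
have PRm : algebra_partition P `<=` Rmu v Rg mu.
  move=> A /(finite_subalgebra_sub Palg).
  by case: Palg => _ PR _ _ _; exact: PR.
have Pcov := subcover_algebra_partition Palg.
(* It remains to bound the entropy of [U] by that of [P]: the two sequences attached to [P]
   coincide, and the partition of [P] refines [U]. *)
apply: (@le_trans _ _ (h_mu_alg v Rg mu T P)); last first.
  by apply: ereal_sup_ubound; exists P.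
have H_muE : H_mu_seq v Rg mu T P =
    fun n => (n.+1%:R^-1 * H_top R (cover_iter TY (algebra_partition P) n))%:E.
  apply/funext => n; have [Pfin ->] := H_top_partition TY n Palg.
  rewrite EFinM /H_mu_seq; congr (_ * _)%E; apply: H_mu_eq => // A.
  rewrite algebra_partition_iter => -[PA A0]; apply: norm1 => //.
  exact: (cover_iter_ring Rm_ring RmT X_compact T_cont PRm) PA.
rewrite /h_mu_alg H_muE is_cvg_limn_esupE; last exact: cvg_top.
(* The finite subcover of [U] inherited from the partition yields convergence of the sequence of
   [U]. *)
have [t Ut _] := subcover_refines PU Pcov.
apply: lee_lim; [exact: is_cvg_h_top_cover Ut|exact: cvg_top|apply: nearW => n].
rewrite lee_fin ler_wpM2l ?invr_ge0// ler_log2//.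
have [t' Pt'] := subcover_iter TY n Pcov.
by apply: cover_number_refines Pt'; exact: cover_iter_refines.
Qed.
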